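(* Let $\alpha\in\Omega(r)$. A finite dimensional vector space $\mathfrak M$ of $\mathbb C^m$-valued functions (analytic in an open set containing $r^{-1}\{\alpha\}$) is $R^{(r)}_\alpha$-invariant if and only if it is spanned by the columns of a matrix function of the form $$\mathsf M(z)=(Z_r(z)\otimes I_m)\,C\,(A-r(z)B)^{-1},$$ where, for some integer $M$, $C\in\mathbb C^{mN\times M}$ and $A,B\in\mathbb C^{M\times M}$ satisfy $\det(A-\alpha B)\ne0$. Furthermore, $M$ can be chosen to be the dimension of $\mathfrak M$, and one can always assume that $A-\alpha B=I_M$. For a fixed choice of $Z_r(z)$, this representation (with $M=\dim\mathfrak M$ and $A-\alpha B=I_M$) is unique up to a similarity matrix: if $(C,A,B)$ and $(C_1,A_1,B_1)$ are two such representations of $\mathfrak M$, there is an invertible $S\in\mathbb C^{M\times M}$ such that $$C_1=CS,\qquad A_1=S^{-1}AS,\qquad B_1=S^{-1}BS.$$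
   Context: $r=P/Q$ is a rational function, $P,Q$ coprime polynomials, $\deg P\ge\deg Q$, $N=\deg P\ge1$. $\mathfrak L(r)$ is the $N$-dimensional linear span of the functions $z\mapsto\frac{r(z)-r(a)}{z-a}$, $a$ a point of analyticity of $r$; $e_1,\ldots,e_N$ is a fixed basis of $\mathfrak L(r)$ and $Z_r(z)=(e_1(z)\ \cdots\ e_N(z))$. $\Omega(r)$ is the set of $\alpha\in\mathbb C$ for which $r(z)=\alpha$ has $N$ pairwise different roots $w_1,\ldots,w_N$. For $\alpha\in\Omega(r)$ and $f$ analytic in a neighborhood of these roots, $$(R^{(r)}_\alpha f)(z)=\frac{f(z)}{r(z)-\alpha}-\sum_{n=1}^N\frac{f(w_n)}{r'(w_n)(z-w_n)},\quad r(z)\ne\alpha,$$ extended analytically across the removable singularities $w_1,\ldots,w_N$. $R^{(r)}_\alpha$-invariant means $R^{(r)}_\alpha\mathfrak M\subset\mathfrak M$. Functions are identified when they agree outside removable singularities. *)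

(* Defs.v *)
From HB Require Import structures.
From mathcomp Require Export all_boot all_order all_algebra.
From mathcomp Require Export complex mxtens.
From mathcomp Require Export all_classical all_reals all_analysis.
Export numFieldNormedType.Exports.

Set Implicit Arguments.
Unset Strict Implicit.
Unset Printing Implicit Defensive.

Import Order.TTheory GRing.Theory Num.Theory.

Local Open Scope classical_set_scope.
Local Open Scope card_scope.
Local Open Scope ring_scope.

(* The canonical topology, norm and derivative are attached to an
   abstract [numClosedFieldType], so [R[i]] is packed as one. *)
Definition CC (R : realType) : numClosedFieldType := R[i].

(* A function on a domain [D] is a total function whose values outside [D] are
   irrelevant; two such functions are the same when they agree on [D]. *)
Section FunctionsOnDomain.
Variables (C : numClosedFieldType) (V : lmodType C) (D : set C).

Definition span_on k (F : 'I_k -> C -> V) : set (C -> V) :=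
  [set f | exists c : 'I_k -> C,
    forall z, D z -> f z = \sum_(j < k) c j *: F j z].

Definition free_on k (F : 'I_k -> C -> V) : Prop :=
  forall c : 'I_k -> C,
    (forall z, D z -> \sum_(j < k) c j *: F j z = 0) -> forall j, c j = 0.

Definition basis_on (X : set (C -> V)) k (F : 'I_k -> C -> V) : Prop :=
  X = span_on F /\ free_on F.

Definition dim_on (X : set (C -> V)) (k : nat) : Prop :=
  exists F : 'I_k -> C -> V, basis_on X F.

End FunctionsOnDomain.

Section AnalyticSpaces.
Variables (C : numClosedFieldType) (m : nat).

(* [derivable] is taken over the scalar field [C], so that for the complex
   numbers this is complex differentiability at every point of [U]. *)
Definition analytic_on (U : set C) (f : C -> 'cV[C]_m) : Prop :=
  forall z, U z -> derivable f z 1.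

(* The last condition says that membership only depends on the values on [U]. *)
Definition analytic_space (U : set C) (X : set (C -> 'cV[C]_m)) : Prop :=
  [/\ forall f, X f -> analytic_on U f,
      X (fun=> 0),
      forall f g, X f -> X g -> X (fun z => f z + g z),
      forall (a : C) f, X f -> X (fun z => a *: f z)
    & forall f g, X f -> (forall z, U z -> g z = f z) -> X g].

End AnalyticSpaces.

Section RationalFunction.
Variables (C : numClosedFieldType) (P Q : {poly C}).

Definition rat_eval (z : C) : C := P.[z] / Q.[z].

(* When [P] and [Q] are coprime, these are the points of analyticity. *)
Definition rat_dom : set C := [set z | Q.[z] != 0].

Definition rat_fiber (alpha : C) : set C :=
  [set z | rat_dom z /\ rat_eval z = alpha].

Definition Omega : set C :=
  [set alpha | rat_fiber alpha #= `I_((size P).-1)].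

(* Extended across its removable singularity at [z = a]. *)
Definition diff_quot (a z : C) : C :=
  if z == a then derive1 rat_eval a
  else (rat_eval z - rat_eval a) / (z - a).

Definition Lspace : set (C -> C^o) :=
  [set f | exists k (a : 'I_k -> C), (forall j, rat_dom (a j)) /\
    span_on rat_dom (fun j : 'I_k => diff_quot (a j) : C -> C^o) f].

Definition Lbasis N (e : 'I_N -> C -> C) : Prop :=
  basis_on rat_dom Lspace (e : 'I_N -> C -> C^o).

Definition Zrow N (e : 'I_N -> C -> C) (z : C) : 'rV[C]_N :=
  \row_(i < N) e i z.

Section Resolvent.
Variable m : nat.

Definition resolvent_expr (alpha : C) (f : C -> 'cV[C]_m) (z : C) : 'cV[C]_m :=
  (rat_eval z - alpha)^-1 *: f z
  - \sum_(w \in rat_fiber alpha)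
      (derive1 rat_eval w * (z - w))^-1 *: f w.

(* The poles of [r] are removable singularities too: there [1 / (r - alpha)]
   vanishes, whereas [rat_eval] takes the junk value [0]. *)
Definition resolvent (alpha : C) (f : C -> 'cV[C]_m) (z : C) : 'cV[C]_m :=
  if (Q.[z] != 0) && (rat_eval z != alpha) then resolvent_expr alpha f z
  else lim (resolvent_expr alpha f @ z^').

Definition resolvent_invariant (alpha : C) (X : set (C -> 'cV[C]_m)) : Prop :=
  forall f, X f -> X (resolvent alpha f).

End Resolvent.

Section Representation.
Variables (N m M : nat) (e : 'I_N -> C -> C).
Implicit Types (G : 'M[C]_(N * m, M)) (A B : 'M[C]_M).

(* [castmx] identifies the height [1 * m] of the Kronecker product with [m]. *)
Definition repr_mx G A B (z : C) : 'M[C]_(m, M) :=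
  castmx (mul1n m, erefl) (Zrow e z *t 1%:M)
    *m G *m invmx (A - rat_eval z *: B).

Definition repr_dom A B : set C :=
  [set z | rat_dom z /\ A - rat_eval z *: B \in unitmx].

(* [F j] is the [j]-th column of [repr_mx G A B], extended to a function
   analytic on [U] by its being an element of [X]. *)
Definition spanned_by_columns (U : set C) (X : set (C -> 'cV[C]_m)) G A B :
    Prop :=
  exists F : 'I_M -> C -> 'cV[C]_m,
    (forall j z, U z -> repr_dom A B z -> F j z = col j (repr_mx G A B z))
    /\ X = span_on U F.

End Representation.
End RationalFunction.

(* Main.v *)
Require Import Defs.
From mathcomp Require Import ring.
Import Order.TTheory GRing.Theory Num.Theory.
Local Open Scope classical_set_scope.
Local Open Scope ring_scope.

(** Write [r = P / Q] and let [w_1, ..., w_N] be the [N] simple roots of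
    [r = alpha].  The functions
    [ell_n z = diff_quot (w_n) z / r'(w_n)] (called [cardinal_fun]) lie in
    [L(r)] and satisfy [ell_n (w_j) = (n == j)].  Every element of [L(r)] is
    [p / Q] with [deg p < N], hence is determined by its values at the [w_n],
    and [g = \sum_n g(w_n) ell_n] for all [g] in [L(r)]
    ([Lspace_interpolation]).  Away from the fiber,
    [ell_n z = (r z - alpha) / (r'(w_n) (z - w_n))], so the resolvent reads
    [R f = (r - alpha)^-1 (f - K f)], where
    [K f = \sum_n f(w_n) ell_n] interpolates [f] by an element of
    [L(r) (x) C^m] ([resolvent_exprE]).  In other words [R f = g] says that
    [f - (r - alpha) g = K f].

    Let the columns of a matrix function [F] span the space.  If the space is
    invariant, then [R F = F B] for some constant matrix [B], that is
    [F (1 - (r - alpha) B) = K F].  The right hand side is [(Z (x) 1) G] for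
    a constant [G], because the entries of [Z] form a basis of [L(r)]; this is
    the representation with [A = 1 + alpha B] ([invariant_columns]).

    Conversely a representation with [A - alpha B = 1] gives the pencil
    equation [F (A - r B) = (Z (x) 1) G] ([columns_pencil_eq]).  At [w_n] it
    says [F(w_n) = (Z(w_n) (x) 1) G], so by interpolation the right hand side is
    [K F], and the equation becomes [R F = F B] ([resolvent_pencil]): the
    space is invariant.  The general case reduces to this one by replacing
    [G, A, B] with [G T^-1, A T^-1, B T^-1], [T = A - alpha B], which leaves
    [F] unchanged ([normalize_columns]).

    For uniqueness, [d] functions spanning a [d]-dimensional space are free, so
    two representations are related by [F1 = F S] with [S] invertible.  The
    values at the [w_n] determine [G], which gives [G1 = G S], and
    [R F1 = F1 B1 = F S B1], [R (F S) = F B S] give [S B1 = B S]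
    ([columns_unique]).

    Analysis enters through two facts only: equalities between functions
    continuous on the open set [U] extend over the finitely many zeros of a
    nonzero polynomial, and the derivative of [r] at [a] is the value at [a]
    of the divided difference. *)

Set Implicit Arguments.
Unset Strict Implicit.
Unset Printing Implicit Defensive.

(** * Continuity and removable points *)

Section Analysis.
Variable C : numClosedFieldType.
Implicit Types (p P Q h : {poly C}) (z a : C).

Lemma continuous_poly p : continuous (horner p : C -> C).
Proof.
elim/poly_ind: p => [|p c IH].
  have -> : (horner (0 : {poly C}) : C -> C) = (fun=> 0).
    by apply/funext => x; rewrite horner0.
  exact: cst_continuous.
have -> : (horner (p * 'X + c%:P) : C -> C) = (fun x => p.[x] * x + c).
  by apply/funext => x; rewrite hornerMXaddC.
move=> z; apply: (@cvgD C C C (nbhs z)); last exact: cvg_cst.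
by apply: (@cvgM C C (nbhs z)); [exact: IH | exact: cvg_id].
Qed.

Lemma near_poly_neq0 p z : p.[z] != 0 -> \forall x \near z, p.[x] != 0.
Proof.
exact: (@cvgr_neq0 _ C C (nbhs z) _ (horner p) _ (@continuous_poly p z)).
Qed.

(** The root [z] of [p], of whatever multiplicity, is isolated: factor out the
    powers of ['X - z] and use that the cofactor does not vanish near [z]. *)
Lemma dnbhs_poly_neq0 p z : p != 0 -> \forall x \near z^', p.[x] != 0.
Proof.
move=> p0; have [k [q]] := multiplicity_XsubC p z; rewrite p0 /= => qz pE.
have /nbhs_dnbhs qx0 := near_poly_neq0 qz.
near=> x; rewrite pE hornerM horner_exp hornerXsubC mulf_neq0 //.
  by near: x.
by rewrite expf_neq0 // subr_eq0; near: x; exact: nbhs_dnbhs_neq.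
Unshelve. all: by end_near. Qed.

Lemma rat_divided_diff P Q h a z : Q.[a] != 0 -> Q.[z] != 0 ->
  P - rat_eval P Q a *: Q = h * ('X - a%:P) ->
  rat_eval P Q z - rat_eval P Q a = (z - a) * (h.[z] / Q.[z]).
Proof.
move=> Qa Qz /(congr1 (fun p => p.[z])) E.
rewrite hornerM !hornerD !hornerN hornerZ hornerX hornerC in E.
by rewrite mulrCA mulrA -E mulrBl mulfK.
Qed.

Lemma derive1_rat_eval P Q h a : Q.[a] != 0 ->
  P - rat_eval P Q a *: Q = h * ('X - a%:P) ->
  derive1 (rat_eval P Q) a = h.[a] / Q.[a].
Proof.
move=> Qa hE; apply: cvg_lim; first exact: norm_hausdorff.
have cq : {for a, continuous (fun z : C => h.[z] / Q.[z])}.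
  apply: (@cvgM C C (nbhs a)); first exact: continuous_poly.
  by apply: (@cvgV C C (nbhs a)) => //; exact: continuous_poly.
move/continuous_withinNshiftx: (cq); apply: cvg_trans; apply: near_eq_cvg.
have QQ : \forall x \near 0^', Q.[x + a] != 0.
  apply: nbhs_dnbhs; have := near_poly_neq0 Qa.
  by rewrite (near_shift 0) subr0.
near=> x; have x0 : x != 0 by near: x; exact: nbhs_dnbhs_neq.
rewrite (rat_divided_diff Qa _ hE); last by near: x.
by rewrite addrK /= scalerA mulVf // scale1r.
Unshelve. all: by end_near. Qed.

Lemma eq_dnbhs (f g : C -> C) z : {for z, continuous f} ->
  {for z, continuous g} -> (\forall x \near z^', f x = g x) -> f z = g z.
Proof.
move=> /continuous_withinNx fz /continuous_withinNx gz fg.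
apply: (cvg_unique (@norm_hausdorff C C) fz).
by apply: cvg_trans gz; apply: near_eq_cvg; apply: filterS fg => x ->.
Qed.

Lemma derivable_coord m (f : C -> 'cV[C]_m) z i j : derivable f z 1 ->
  {for z, continuous (fun x => f x i j)}.
Proof.
move=> /derivable1_diffP/differentiable_continuous fz.
exact: (continuous_comp fz (@coord_continuous _ _ _ i j _)).
Qed.

Lemma continuous_at_sum (V : normedModType C) M (f : 'I_M -> C -> V) z :
  (forall k, {for z, continuous (f k)}) ->
  {for z, continuous (fun x => \sum_k f k x)}.
Proof.
elim: M f => [|M IH] f fz.
  have -> : (fun x => \sum_(k < 0) f k x) = (fun=> 0); last exact: cst_continuous.
  by apply/funext => x; rewrite big_ord0.
have -> : (fun x => \sum_k f k x) =
    (fun x => f ord0 x + \sum_k f (lift ord0 k) x); last first.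
  by apply: (@cvgD C V C (nbhs z)); [exact: fz | apply: IH => k; exact: fz].
by apply/funext => x; rewrite big_ord_recl.
Qed.

(** Clearing denominators turns an identity between matrices of rational
    functions and continuous functions into relations of this shape, which
    survive at points where the original identity is not available. *)
Lemma poly_relation_extend M (f : 'I_M -> C -> C) (p : 'I_M -> {poly C}) q z :
  (forall k, {for z, continuous (f k)}) ->
  (\forall x \near z^', \sum_k f k x * (p k).[x] = q.[x]) ->
  \sum_k f k z * (p k).[z] = q.[z].
Proof.
move=> fz; apply: eq_dnbhs; last exact: continuous_poly.
apply: continuous_at_sum => k; apply: (@cvgM C C (nbhs z)); first exact: fz.
exact: continuous_poly.
Qed.

End Analysis.

(** * The space L(r) and the fiber *)

Section DivisionByLinearFactor.
Variables (C : numClosedFieldType) (P Q : {poly C}).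
Local Notation r := (rat_eval P Q).

(** The numerator over [Q] of the divided difference
    [(r z - r a) / (z - a)]. *)
Definition dq_num (a : C) : {poly C} := (P - r a *: Q) %/ ('X - a%:P).

Lemma dq_numK a : Q.[a] != 0 -> P - r a *: Q = dq_num a * ('X - a%:P).
Proof.
move=> Qa; rewrite divpK // dvdp_XsubCl /root.
by rewrite hornerD hornerN hornerZ divfK // subrr.
Qed.

Lemma size_dq_num a : (size Q <= size P)%N -> (size (dq_num a) <= (size P).-1)%N.
Proof.
move=> QP; rewrite size_divp ?polyXsubC_eq0 // size_XsubC subn1.
rewrite -!subn1 leq_sub2r // (leq_trans (size_polyD _ _)) // geq_max leqnn.
by rewrite size_polyN (leq_trans (size_scale_leq _ _)).
Qed.

Lemma derive1_dq_num a : Q.[a] != 0 -> derive1 r a = (dq_num a).[a] / Q.[a].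
Proof. by move=> Qa; exact: derive1_rat_eval (dq_numK Qa). Qed.

(** Both branches of [diff_quot] are values of one rational function, the
    branch [z = a] because [r'(a)] is the limit of the other one. *)
Lemma diff_quotE a z : Q.[a] != 0 -> Q.[z] != 0 ->
  diff_quot P Q a z = (dq_num a).[z] / Q.[z].
Proof.
move=> Qa Qz; rewrite /diff_quot; case: eqVneq => [->|za].
  exact: derive1_dq_num.
by rewrite (rat_divided_diff Qa Qz (dq_numK Qa)) mulrC mulKf // subr_eq0.
Qed.

Lemma Lspace_poly f : (size Q <= size P)%N -> Lspace P Q f ->
  exists2 p : {poly C}, (size p <= (size P).-1)%N &
    forall z, Q.[z] != 0 -> f z = p.[z] / Q.[z].
Proof.
move=> QP [k [a [aQ [c fE]]]].
exists (\sum_j c j *: dq_num (a j)).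
  apply: (leq_trans (size_sum _ _ _)); apply/bigmax_leqP => j _.
  exact: leq_trans (size_scale_leq _ _) (size_dq_num _ QP).
move=> z Qz; rewrite fE // horner_sum mulr_suml; apply: eq_bigr => j _.
by rewrite diff_quotE ?hornerZ -?mulrA //; exact: aQ.
Qed.

Lemma fiber_enum alpha N : size P = N.+1 -> Omega P Q alpha ->
  exists w : 'I_N -> C, [/\ injective w, forall n, rat_fiber P Q alpha (w n)
    & forall z, rat_fiber P Q alpha z -> exists n, z = w n].
Proof.
move=> PN; rewrite /Omega /= PN card_eq_sym => /card_set_bijP[g [gfun ginj gsurj]].
exists (fun n => g n); split.
- by move=> i j /ginj E; apply/val_inj/E; rewrite inE; exact: ltn_ord.
- by move=> n; apply: gfun; exact: ltn_ord.
- by move=> z /gsurj[n nN <-]; exists (Ordinal nN).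
Qed.

End DivisionByLinearFactor.

(** * Interpolation at the fiber *)

Section Interpolation.
Variables (C : numClosedFieldType) (P Q : {poly C}) (N : nat).
Hypotheses (hPQ : coprimep P Q) (hdeg : (size Q <= size P)%N)
  (hN : size P = N.+1) (N_gt0 : (0 < N)%N).
Variables (alpha : C) (w : 'I_N -> C).
Hypotheses (winj : injective w) (wfib : forall n, rat_fiber P Q alpha (w n)).
Local Notation r := (rat_eval P Q).

Definition cardinal_fun n z := (derive1 r (w n))^-1 * diff_quot P Q (w n) z.

(** This is where having [N] distinct points in the fiber is used: elements of
    [L(r)] have numerators of degree less than [N]. *)
Lemma roots_w_eq0 (p : {poly C}) : (size p <= N)%N ->
  (forall n, p.[w n] = 0) -> p = 0.
Proof.
move=> pN pw; apply: (@roots_geq_poly_eq0 _ p (map w (enum 'I_N))).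
- by apply/allP => _ /mapP[n _ ->]; apply/eqP.
- by rewrite map_inj_uniq ?enum_uniq.
- by rewrite size_map size_enum_ord.
Qed.

(** [dq_num (w n)] times ['X - w n] is [P - alpha Q], which vanishes on the
    whole fiber. *)
Lemma dq_num_w_neq n j : n != j -> (dq_num P Q (w n)).[w j] = 0.
Proof.
move=> nj; have [Qn rn] := wfib n; have [Qj rj] := wfib j.
have := congr1 (fun p => p.[w j]) (dq_numK P Qn).
rewrite rn hornerM !(hornerD, hornerN) hornerZ hornerX hornerC.
rewrite -rj divfK // subrr => /esym/eqP.
by rewrite mulf_eq0 subr_eq0 inj_eq // [j == n]eq_sym (negPf nj) orbF => /eqP.
Qed.

(** The roots of [P - alpha Q] are simple, i.e. [r'(w n) != 0]: otherwise
    [dq_num (w n)] would vanish on the whole fiber, hence identically, and [P]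
    would be a multiple of [Q], against coprimality. *)
Lemma dq_num_w_neq0 n : (dq_num P Q (w n)).[w n] != 0.
Proof.
have [Qn rn] := wfib n; apply/eqP => dn0.
have d0 : dq_num P Q (w n) = 0.
  apply: roots_w_eq0 => [|j]; first by have := size_dq_num (w n) hdeg; rewrite hN.
  by have [<-//|nj] := eqVneq n j; apply: dq_num_w_neq.
have := dq_numK P Qn; rewrite d0 mul0r => /subr0_eq PE.
have c0 : r (w n) != 0.
  by apply/eqP => c0; have := hN; rewrite PE c0 scale0r size_poly0.
have QN : size Q = N.+1 by rewrite -hN PE size_scale.
by move: hPQ; rewrite PE coprimepZl // coprimepp QN eqSS; case: (N) N_gt0.
Qed.

Lemma cardinal_funE n z : Q.[z] != 0 ->
  cardinal_fun n z =
  (Q.[w n] / (dq_num P Q (w n)).[w n]) * ((dq_num P Q (w n)).[z] / Q.[z]).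
Proof.
by move=> Qz; have [Qn _] := wfib n;
  rewrite /cardinal_fun diff_quotE // derive1_dq_num // invf_div.
Qed.

Lemma cardinal_fun_w n j : cardinal_fun n (w j) = (n == j)%:R.
Proof.
have [Qn _] := wfib n; have [Qj _] := wfib j.
rewrite cardinal_funE //; have [<-|nj] := eqVneq n j; last first.
  by rewrite (dq_num_w_neq nj) mul0r mulr0.
by rewrite mulf_div [Q.[w n] * _]mulrC divff // mulf_neq0 // dq_num_w_neq0.
Qed.

(** The link with the resolvent, whose correction terms are
    [(derive1 r (w n) * (z - w n))^-1]. *)
Lemma cardinal_fun_off n z : Q.[z] != 0 -> r z != alpha ->
  cardinal_fun n z = (r z - alpha) * (derive1 r (w n) * (z - w n))^-1.
Proof.
move=> Qz rz; have [_ rn] := wfib n; rewrite /cardinal_fun /diff_quot.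
case: eqVneq => [zw|_]; first by rewrite zw rn eqxx in rz.
by rewrite rn invfM mulrCA.
Qed.

(** Equivalently, the resolvent at [alpha] annihilates [L(r)]. *)
Lemma Lspace_interpolation f z : Lspace P Q f -> Q.[z] != 0 ->
  f z = \sum_n f (w n) * cardinal_fun n z.
Proof.
move=> /(Lspace_poly hdeg)[p pN fE] Qz; rewrite hN /= in pN.
pose q := \sum_n (p.[w n] / (dq_num P Q (w n)).[w n]) *: dq_num P Q (w n).
have pq : p = q.
  apply/subr0_eq/roots_w_eq0 => [|j].
    rewrite (leq_trans (size_polyD _ _)) // geq_max pN size_polyN.
    apply: (leq_trans (size_sum _ _ _)); apply/bigmax_leqP => n _.
    apply: leq_trans (size_scale_leq _ _) _.
    by have := size_dq_num (w n) hdeg; rewrite hN.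
  rewrite hornerD hornerN horner_sum (bigD1 j) //= big1 => [|n nj].
    by rewrite hornerZ divfK ?dq_num_w_neq0 // addr0 subrr.
  by rewrite hornerZ (dq_num_w_neq nj) mulr0.
rewrite fE // pq horner_sum mulr_suml; apply: eq_bigr => n _.
have [Qn _] := wfib n.
rewrite hornerZ cardinal_funE // fE // !mulrA; congr (_ / _ * _ / _).
by rewrite mulrAC mulfK.
Qed.

Lemma cardinal_fun_Lspace n : Lspace P Q (cardinal_fun n).
Proof.
have [Qn _] := wfib n; exists 1%N, (fun=> w n); split=> //.
by exists (fun=> (derive1 r (w n))^-1) => z _; rewrite big_ord1.
Qed.

End Interpolation.

(** * The pencil A - r B *)

Section PencilDet.
Variables (C : numClosedFieldType) (P Q : {poly C}).
Local Notation r := (rat_eval P Q).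

(** The polynomial is [\det (Q A - P B)], which is [Q ^+ M] times the
    determinant of the pencil. *)
Lemma pencil_unit_poly M (A B : 'M[C]_M) a : Q.[a] != 0 ->
  A - r a *: B \in unitmx ->
  exists2 p : {poly C}, p != 0 & forall z, Q.[z] != 0 -> p.[z] != 0 ->
    A - r z *: B \in unitmx.
Proof.
pose L := map_mx (fun x => x *: Q) A - map_mx (fun x => x *: P) B.
have LE z : Q.[z] != 0 -> (\det L).[z] = Q.[z] ^+ M * \det (A - r z *: B).
  move=> Qz; rewrite -horner_evalE -det_map_mx -detZ; congr (\det _).
  apply/matrixP => i j; rewrite !mxE.
  transitivity (A i j *: Q - B i j *: P).[z] => //.
  rewrite hornerD hornerN !hornerZ.
  by rewrite mulrBr mulrC mulrA [Q.[z] * r z]mulrC divfK // [P.[z] * _]mulrC.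
move=> Qa; rewrite unitmxE unitfE => dA; exists (\det L).
  by apply/eqP => L0; have := LE a Qa; rewrite L0 horner0 => /esym/eqP;
    rewrite mulf_eq0 (negPf dA) orbF expf_eq0 (negPf Qa) andbF.
move=> z Qz; rewrite LE // mulf_eq0 negb_or => /andP[_ dz].
by rewrite unitmxE unitfE.
Qed.

End PencilDet.

(** * Constant coefficients over the basis of L(r) *)

Section Representation.
Variables (C : numClosedFieldType) (P Q : {poly C}) (N m : nat).
Hypotheses (hPQ : coprimep P Q) (hdeg : (size Q <= size P)%N)
  (hN : size P = N.+1) (N_gt0 : (0 < N)%N).
Variables (e : 'I_N -> C -> C) (he : Lbasis P Q e).
Variables (alpha : C) (w : 'I_N -> C).
Hypotheses (winj : injective w) (wfib : forall n, rat_fiber P Q alpha (w n))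
  (wsurj : forall z, rat_fiber P Q alpha z -> exists n, z = w n).
Local Notation r := (rat_eval P Q).
Local Notation ell := (cardinal_fun P Q w).

(** The factor of [repr_mx] on the left of the constant matrix.  The
    [C^m]-valued functions with components in [L(r)] are the columns of the
    [Zmx z *m G], [G] constant. *)
Definition Zmx (z : C) : 'M[C]_(m, N * m) :=
  castmx (mul1n m, erefl) (Zrow e z *t 1%:M).

Definition colsmx M (F : 'I_M -> C -> 'cV[C]_m) z : 'M[C]_(m, M) :=
  \matrix_(i, k) F k z i 0.

Lemma col_colsmx M (F : 'I_M -> C -> 'cV[C]_m) z k : col k (colsmx F z) = F k z.
Proof. by apply/colP => i; rewrite !mxE. Qed.

Lemma colsmx_mul M (F : 'I_M -> C -> 'cV[C]_m) z (c : 'cV[C]_M) :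
  colsmx F z *m c = \sum_k c k 0 *: F k z.
Proof.
apply/colP => i; rewrite !mxE summxE; apply: eq_bigr => k _.
by rewrite !mxE mulrC.
Qed.

Lemma mul_Zmx M (G : 'M[C]_(N * m, M)) z i k :
  (Zmx z *m G) i k = \sum_j e j z * G (mxtens_index (j, i)) k.
Proof.
rewrite mxE (reindex (@mxtens_index N m)) /=; last first.
  by exists (@mxtens_unindex N m) => x _; rewrite ?mxtens_indexK ?mxtens_unindexK.
transitivity (\sum_j \sum_l
    Zmx z i (mxtens_index (j, l)) * G (mxtens_index (j, l)) k).
  by rewrite pair_bigA; apply: eq_bigr => -[].
apply: eq_bigr => j _.
have ZE l : Zmx z i (mxtens_index (j, l)) = e j z * (i == l)%:R.
  rewrite castmxE /= cast_ord_id mxE mxtens_indexK /= !mxE; congr (_ * (_ == _)%:R).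
  by apply/val_inj; rewrite /= modn_small.
rewrite (bigD1 i) //= big1 => [|l li]; first by rewrite ZE eqxx mulr1 addr0.
by rewrite ZE eq_sym (negPf li) mulr0 mul0r.
Qed.

(** Expanding each cardinal function in the basis [e] yields the constant
    matrix of any interpolation problem on the fiber. *)
Lemma interpolant_Zmx M (H : 'I_N -> 'M[C]_(m, M)) :
  exists G : 'M[C]_(N * m, M), forall z, Q.[z] != 0 ->
    Zmx z *m G = \sum_n ell n z *: H n.
Proof.
have [LE _] := he.
have /choice[t tE] : forall n, exists t : 'I_N -> C, forall z, Q.[z] != 0 ->
    ell n z = \sum_j t j * e j z.
  by move=> n; have := cardinal_fun_Lspace wfib n; rewrite LE.
exists (\matrix_(x, k) \sum_n t n (mxtens_unindex x).1 *
  H n (mxtens_unindex x).2 k) => z Qz.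
apply/matrixP => i k; rewrite mul_Zmx summxE.
under eq_bigr do rewrite mxE mxtens_indexK /= mulr_sumr.
rewrite exchange_big /=; apply: eq_bigr => n _.
rewrite mxE tE // mulr_suml; apply: eq_bigr => j _.
by rewrite mulrA [e j z * _]mulrC.
Qed.

Lemma e_Lspace j : Lspace P Q (e j).
Proof.
have [-> _] := he; exists (fun i => (i == j)%:R) => z _.
rewrite (bigD1 j) //= eqxx scale1r big1 ?addr0 // => i /negPf->.
by rewrite scale0r.
Qed.

Lemma Zmx_interpolation M (G : 'M[C]_(N * m, M)) z : Q.[z] != 0 ->
  Zmx z *m G = \sum_n ell n z *: (Zmx (w n) *m G).
Proof.
move=> Qz; apply/matrixP => i k; rewrite mul_Zmx summxE.
under eq_bigr => j _ do
  rewrite (Lspace_interpolation hPQ hdeg hN N_gt0 winj wfib (e_Lspace j) Qz)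
    mulr_suml.
rewrite exchange_big /=; apply: eq_bigr => n _.
rewrite mxE mul_Zmx mulr_sumr; apply: eq_bigr => j _.
by rewrite mulrAC [RHS]mulrC.
Qed.

(** By interpolation, values on the fiber determine the functions
    [Zmx z *m G], and freeness of [e] determines [G] from these functions. *)
Lemma Zmx_inj M (G G' : 'M[C]_(N * m, M)) :
  (forall n, Zmx (w n) *m G = Zmx (w n) *m G') -> G = G'.
Proof.
move=> GG; apply/subr0_eq/matrixP => x k; have [_ efree] := he.
rewrite -(mxtens_unindexK x) [RHS]mxE; case: (mxtens_unindex x) => j i.
pose c j := (G - G') (mxtens_index (j, i)) k.
apply: (efree c) => z Qz.
transitivity ((Zmx z *m (G - G')) i k).
  by rewrite mul_Zmx; apply: eq_bigr => l _; exact: mulrC.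
rewrite Zmx_interpolation // big1 ?mxE // => n _.
by rewrite mulmxBr GG subrr scaler0.
Qed.

(** The representation with its denominator cleared.  Unlike the formula of
    [repr_mx] it makes sense at every point of [U] that is not a pole. *)
Definition pencil_eq (U : set C) M (F : 'I_M -> C -> 'cV[C]_m)
    (G : 'M[C]_(N * m, M)) (A B : 'M[C]_M) : Prop :=
  forall z, U z -> Q.[z] != 0 ->
    colsmx F z *m (A - r z *: B) = Zmx z *m G.

(** * The resolvent and the pencil equation *)

Section OnOpenSet.
Variables (U : set C) (hU : open U) (hfiber : rat_fiber P Q alpha `<=` U).

(** The representation formula gives the equation only where the pencil is
    invertible, i.e. off the zeros of a polynomial; multiplied by [Q], both
    sides are continuous and the equation extends. *)
Lemma columns_pencil_eq M (F : 'I_M -> C -> 'cV[C]_m) G A B :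
  (forall k, analytic_on U (F k)) -> A - alpha *: B \in unitmx ->
  (forall k z, U z -> repr_dom P Q A B z ->
     F k z = col k (repr_mx P Q e G A B z)) ->
  pencil_eq U F G A B.
Proof.
move=> Fan AB FE z Uz Qz.
have [Q0 r0] := wfib (Ordinal N_gt0).
have [p p0 pE] : exists2 p : {poly C}, p != 0 & forall z, Q.[z] != 0 ->
    p.[z] != 0 -> A - r z *: B \in unitmx.
  by apply: pencil_unit_poly Q0 _; rewrite r0.
have /choice[q qE] : forall j, exists q : {poly C}, forall z, Q.[z] != 0 ->
    e j z = q.[z] / Q.[z].
  by move=> j; have [q _ qE] := Lspace_poly hdeg (e_Lspace j); exists q.
have QpU : \forall x \near z^', [/\ U x, Q.[x] != 0 & p.[x] != 0].
  have UN : \forall x \near z^', U x by apply: nbhs_dnbhs; exact: open_nbhs_nbhs.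
  have QN : \forall x \near z^', Q.[x] != 0.
    by apply: nbhs_dnbhs; exact: near_poly_neq0.
  have pN := dnbhs_poly_neq0 z p0.
  by near=> x; split; near: x.
have step x i k : Q.[x] != 0 ->
    ((colsmx F x *m (A - r x *: B)) i k == (Zmx x *m G) i k) =
    (\sum_l F l x i 0 * (A l k *: Q - B l k *: P).[x] ==
     (\sum_j G (mxtens_index (j, i)) k *: q j).[x]).
  move=> Qx; rewrite -(inj_eq (mulIf Qx)) mul_Zmx mxE !mulr_suml horner_sum.
  congr (_ == _); apply: eq_bigr => l _.
    rewrite !mxE -mulrA hornerD hornerN !hornerZ mulrBl.
    by rewrite [r x * _]mulrC -[B l k * r x * _]mulrA divfK.
  by rewrite qE // mulrAC divfK // hornerZ mulrC.
apply/matrixP => i k; apply/eqP; rewrite step //; apply/eqP.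
apply: (@poly_relation_extend _ _ (fun l x => F l x i 0)
  (fun l => A l k *: Q - B l k *: P)).
  by move=> l; apply: derivable_coord; exact: Fan.
apply: filterS QpU => x [Ux Qx px]; apply/eqP; rewrite -step //; apply/eqP.
suff -> : colsmx F x = repr_mx P Q e G A B x by rewrite mulmxKV ?pE.
by apply/matrixP => a b; rewrite mxE FE // ?mxE //; split=> //; exact: pE.
Unshelve. all: by end_near. Qed.

Lemma pencil_eq_columns M (F : 'I_M -> C -> 'cV[C]_m) G A B :
  pencil_eq U F G A B ->
  forall k z, U z -> repr_dom P Q A B z -> F k z = col k (repr_mx P Q e G A B z).
Proof.
move=> pen k z Uz [Qz ABz].
by rewrite /repr_mx -/(Zmx z) -pen // mulmxK // col_colsmx.
Qed.

(** On the fiber the pencil is [A - alpha *: B]. *)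
Lemma pencil_eq_fiber M (F : 'I_M -> C -> 'cV[C]_m) G A B n :
  A - alpha *: B = 1%:M -> pencil_eq U F G A B ->
  Zmx (w n) *m G = colsmx F (w n).
Proof.
move=> AB pen; have [Qn rn] := wfib n.
by rewrite -pen ?rn ?AB ?mulmx1 //; apply: hfiber; exact: wfib.
Qed.

Lemma fiber_sum (V : nmodType) (F : C -> V) :
  \sum_(x \in rat_fiber P Q alpha) F x = \sum_n F (w n).
Proof.
rewrite (reindex_fsbig w [set` predT]).
  rewrite -(@bigfs _ _ _ _ (index_enum 'I_N)) // ?index_enum_uniq // => i _.
  by rewrite mem_index_enum.
by split=> [n _|n j _ _ /winj//|z /wsurj[n ->]]; [exact: wfib | exists n].
Qed.

Lemma resolvent_exprE f z : Q.[z] != 0 -> r z != alpha ->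
  resolvent_expr P Q alpha f z =
  (r z - alpha)^-1 *: (f z - \sum_n ell n z *: (f (w n) : 'cV[C]_m)).
Proof.
move=> Qz rz; rewrite /resolvent_expr fiber_sum scalerBr scaler_sumr; congr (_ - _).
apply: eq_bigr => n _; rewrite (cardinal_fun_off wfib) //.
by rewrite scalerA mulKf // subr_eq0.
Qed.

(** On [U] the resolvent acts on coordinates with respect to [F] as [B].  Off
    the fiber and the poles this is the pencil equation divided by
    [r - alpha]; at the remaining points the resolvent is a limit, and the right
    hand side is continuous. *)
Lemma resolvent_pencil M (F : 'I_M -> C -> 'cV[C]_m) G A B f (c : 'cV[C]_M) :
  (forall k, analytic_on U (F k)) -> A - alpha *: B = 1%:M ->
  pencil_eq U F G A B -> (forall z, U z -> f z = colsmx F z *m c) ->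
  forall z, U z -> resolvent P Q alpha f z = colsmx F z *m (B *m c).
Proof.
move=> Fan AB pen fE.
have expr z : U z -> Q.[z] != 0 -> r z != alpha ->
    resolvent_expr P Q alpha f z = colsmx F z *m (B *m c).
  move=> Uz Qz rz; rewrite resolvent_exprE // fE //.
  have -> : \sum_n ell n z *: f (w n) = Zmx z *m G *m c.
    rewrite Zmx_interpolation // mulmx_suml; apply: eq_bigr => n _.
    rewrite fE; last exact/hfiber/wfib.
    by rewrite (pencil_eq_fiber n AB pen) scalemxAl.
  rewrite -pen // -mulmxBl -{1}[colsmx F z]mulmx1 -mulmxBr -AB.
  have -> : A - alpha *: B - (A - r z *: B) = (r z - alpha) *: B.
    by apply/matrixP => i j; rewrite !mxE; ring.
  rewrite -scalemxAr -scalemxAl scalerA mulVf ?subr_eq0 // scale1r.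
  by rewrite mulmxA.
move=> z Uz; rewrite /resolvent; case: ifP => [/andP[]|_]; first exact: expr.
apply: cvg_lim; first exact: norm_hausdorff.
have hz : {for z, continuous (fun x => colsmx F x *m (B *m c))}.
  have -> : (fun x => colsmx F x *m (B *m c)) =
      (fun x => \sum_k (B *m c) k 0 *: F k x).
    by apply/funext => x; exact: colsmx_mul.
  apply: continuous_at_sum => k.
  apply: (@cvgZ _ _ _ (nbhs z)); first exact: cvg_cst.
  by have /derivable1_diffP/differentiable_continuous := Fan k z Uz; exact.
move/continuous_withinNx: hz; apply: cvg_trans; apply: near_eq_cvg.
(* The excluded points are zeros of Q and of P - alpha Q. *)
have Pa0 : P - alpha *: Q != 0.
  apply/eqP => Pa0; have [Q0 r0] := wfib (Ordinal N_gt0).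
  have /eqP := dq_num_w_neq0 hPQ hdeg hN N_gt0 winj wfib (Ordinal N_gt0).
  apply; have := dq_numK P Q0; rewrite r0 Pa0 => /esym/eqP.
  by rewrite mulf_eq0 polyXsubC_eq0 orbF => /eqP->; rewrite horner0.
have UN : \forall x \near z^', U x by apply: nbhs_dnbhs; exact: open_nbhs_nbhs.
have Q0 : Q != 0.
  by apply/eqP => Q0; have [] := wfib (Ordinal N_gt0);
    rewrite /rat_dom /= Q0 horner0 eqxx.
have QN := dnbhs_poly_neq0 z Q0.
have PN := dnbhs_poly_neq0 z Pa0.
near=> x; have Qx : Q.[x] != 0 by near: x.
apply/esym/expr => //; first by near: x.
have : (P - alpha *: Q).[x] != 0 by near: x.
by apply: contraNneq => rx; rewrite hornerD hornerN hornerZ -rx divfK // subrr.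
Unshelve. all: by end_near. Qed.

(** * Representations of a space on U *)

Lemma mem_span_on M (F : 'I_M -> C -> 'cV[C]_m) f : span_on U F f <->
  exists c : 'cV[C]_M, forall z, U z -> f z = colsmx F z *m c.
Proof.
split=> [[c fE]|[c fE]].
  exists (\col_k c k) => z Uz; rewrite fE // colsmx_mul.
  by apply: eq_bigr => k _; rewrite mxE.
by exists (fun k => c k 0) => z Uz; rewrite fE // colsmx_mul.
Qed.

Lemma span_on_gen M (F : 'I_M -> C -> 'cV[C]_m) k : span_on U F (F k).
Proof.
apply/mem_span_on; exists (delta_mx k 0) => z _.
by rewrite -colE col_colsmx.
Qed.

Lemma span_on_cols M M' (F : 'I_M -> C -> 'cV[C]_m) (F' : 'I_M' -> C -> 'cV[C]_m) :
  (forall k, span_on U F (F' k)) ->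
  exists T : 'M[C]_(M, M'), forall z, U z -> colsmx F' z = colsmx F z *m T.
Proof.
move=> FF'; have /choice[t tE] := fun k => (mem_span_on F (F' k)).1 (FF' k).
exists (\matrix_(i, k) t k i 0) => z Uz; apply/matrixP => i k.
rewrite mxE tE // !mxE; apply: eq_bigr => j _; by rewrite !mxE.
Qed.

Lemma free_onP M (F : 'I_M -> C -> 'cV[C]_m) : free_on U F <->
  forall M' (T : 'M[C]_(M, M')), (forall z, U z -> colsmx F z *m T = 0) -> T = 0.
Proof.
split=> [Ffree M' T T0|Ffree c c0 j].
  apply/matrixP => i k; rewrite mxE; apply: (Ffree (fun i => T i k)) => z Uz.
  have E : colsmx F z *m col k T = 0 by rewrite colE mulmxA T0 // mul0mx.
  rewrite colsmx_mul in E.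
  by rewrite -[RHS]E; apply: eq_bigr => l _; rewrite mxE.
have /matrixP/(_ j 0) : \col_k c k = 0 :> 'cV[C]_M.
  apply: Ffree => z Uz; rewrite colsmx_mul -[RHS](c0 z Uz).
  by apply: eq_bigr => l _; rewrite mxE.
by rewrite !mxE.
Qed.

Variables (X : set (C -> 'cV[C]_m)) (hX : analytic_space U X).

(** [B] is the matrix of the resolvent on the generators and [G] interpolates
    their values on the fiber.  The pencil equation is the definition of the
    resolvent off the fiber, and the interpolation property on it. *)
Lemma invariant_columns M (F : 'I_M -> C -> 'cV[C]_m) :
  X = span_on U F -> resolvent_invariant P Q alpha X ->
  exists (G : 'M[C]_(N * m, M)) (A B : 'M[C]_M),
    A - alpha *: B = 1%:M /\ spanned_by_columns P Q e U X G A B.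
Proof.
move=> XF inv; have ell_w := cardinal_fun_w hPQ hdeg hN N_gt0 winj wfib.
have [|B RE] := @span_on_cols _ _ F (fun k => resolvent P Q alpha (F k)).
  by move=> k; rewrite -XF; apply: inv; rewrite XF; exact: span_on_gen.
have [G GE] := interpolant_Zmx (fun n => colsmx F (w n)).
exists G, (1%:M + alpha *: B), B; split; first by rewrite addrK.
exists F; split=> //; apply: pencil_eq_columns => z Uz Qz.
rewrite GE // -addrA -scalerBl mulmxDr mulmx1 -scalemxAr -RE //.
have [rz|rz] := eqVneq (r z) alpha.
  have [n zn] := wsurj (conj Qz rz).
  rewrite rz subrr scale0r addr0 zn (bigD1 n) //= ell_w eqxx scale1r.
  by rewrite big1 ?addr0 // => j /negPf jn; rewrite ell_w jn scale0r.
apply/matrixP => i k; rewrite !mxE /resolvent Qz rz /= resolvent_exprE //.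
rewrite !mxE !summxE mulrA -[alpha - _]opprB mulNr divff ?subr_eq0 // mulN1r.
rewrite opprB addrC subrK; apply: eq_bigr => n _; by rewrite !mxE.
Qed.

(** Right multiplication of [G], [A] and [B] by [invmx T] multiplies the pencil
    equation by [invmx T], so that the same functions [F] satisfy it. *)
Lemma normalize_columns M (G : 'M[C]_(N * m, M)) (A B : 'M[C]_M) :
  \det (A - alpha *: B) != 0 -> spanned_by_columns P Q e U X G A B ->
  exists (G' : 'M[C]_(N * m, M)) (A' B' : 'M[C]_M),
    A' - alpha *: B' = 1%:M /\ spanned_by_columns P Q e U X G' A' B'.
Proof.
set T := A - alpha *: B; move=> dT [F [FE XF]].
have uT : T \in unitmx by rewrite unitmxE unitfE.
have [anX _ _ _ _] := hX.
have Fan k : analytic_on U (F k) by apply: anX; rewrite XF; exact: span_on_gen.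
have pen := columns_pencil_eq Fan uT FE.
exists (G *m invmx T), (A *m invmx T), (B *m invmx T); split.
  by rewrite scalemxAl -mulmxBl mulmxV.
exists F; split=> //; apply: pencil_eq_columns => z Uz Qz.
by rewrite scalemxAl -mulmxBl !mulmxA pen.
Qed.

Lemma columns_invariant M (G : 'M[C]_(N * m, M)) (A B : 'M[C]_M) :
  A - alpha *: B = 1%:M -> spanned_by_columns P Q e U X G A B ->
  resolvent_invariant P Q alpha X.
Proof.
move=> AB [F [FE XF]] f; have [anX _ _ _ _] := hX.
have Fan k : analytic_on U (F k) by apply: anX; rewrite XF; exact: span_on_gen.
have pen : pencil_eq U F G A B.
  by apply: columns_pencil_eq => //; rewrite AB unitmx1.
rewrite XF => /mem_span_on[c fE]; apply/mem_span_on; exists (B *m c).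
exact: resolvent_pencil pen fE.
Qed.

(** With a basis [E] of [d] elements, [E = F S] and [F = E T] give [T S = 1];
    as both are square, [S T = 1], so [T] is injective. *)
Lemma span_on_dim_free d (F : 'I_d -> C -> 'cV[C]_m) :
  dim_on U X d -> X = span_on U F -> free_on U F.
Proof.
move=> [E [XE /free_onP Efree]] XF; apply/free_onP.
have [|S ES] := @span_on_cols _ _ F E.
  by move=> k; rewrite -XF XE; exact: span_on_gen.
have [|T FT] := @span_on_cols _ _ E F.
  by move=> k; rewrite -XE XF; exact: span_on_gen.
have /mulmx1C ST : T *m S = 1%:M.
  apply/subr0_eq/Efree => z Uz.
  by rewrite mulmxBr mulmx1 mulmxA -FT // -ES // subrr.
move=> M' Y Y0; rewrite -[Y]mul1mx -ST -mulmxA (_ : T *m Y = 0) ?mulmx0 //.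
by apply: Efree => z Uz; rewrite mulmxA -FT // Y0.
Qed.

(** The resolvent of [F1 = F S] computed in both coordinate systems gives
    [S B1 = B S]; the values on the fiber give [G1 = G S]. *)
Lemma columns_unique d (G G1 : 'M[C]_(N * m, d)) (A B A1 B1 : 'M[C]_d) :
  dim_on U X d ->
  A - alpha *: B = 1%:M -> spanned_by_columns P Q e U X G A B ->
  A1 - alpha *: B1 = 1%:M -> spanned_by_columns P Q e U X G1 A1 B1 ->
  exists S : 'M[C]_d, [/\ S \in unitmx, G1 = G *m S,
    A1 = invmx S *m A *m S & B1 = invmx S *m B *m S].
Proof.
move=> dX AB [F [FE XF]] AB1 [F1 [FE1 XF1]]; have [anX _ _ _ _] := hX.
have Fan k : analytic_on U (F k) by apply: anX; rewrite XF; exact: span_on_gen.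
have Fan1 k : analytic_on U (F1 k) by apply: anX; rewrite XF1; exact: span_on_gen.
have pen : pencil_eq U F G A B.
  by apply: columns_pencil_eq => //; rewrite AB unitmx1.
have pen1 : pencil_eq U F1 G1 A1 B1.
  by apply: columns_pencil_eq => //; rewrite AB1 unitmx1.
have /free_onP Ffree := span_on_dim_free dX XF.
have [|S FS] := @span_on_cols _ _ F F1.
  by move=> k; rewrite -XF XF1; exact: span_on_gen.
have [|T FT] := @span_on_cols _ _ F1 F.
  by move=> k; rewrite -XF1 XF; exact: span_on_gen.
have ST : S *m T = 1%:M.
  apply/subr0_eq/Ffree => z Uz.
  by rewrite mulmxBr mulmx1 mulmxA -FS // -FT // subrr.
have [uS _] := mulmx1_unit ST.
have SB : S *m B1 = B *m S.
  apply/subr0_eq/Ffree => z Uz.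
  have RR (c : 'cV[C]_d) :
      colsmx F z *m (S *m B1) *m c = colsmx F z *m (B *m S) *m c.
    rewrite -!mulmxA [colsmx F z *m _]mulmxA -FS //.
    pose f x := colsmx F1 x *m c.
    rewrite -(resolvent_pencil (f := f) Fan1 AB1 pen1 _ Uz) //.
    rewrite (resolvent_pencil (c := S *m c) Fan AB pen _ Uz) // => x Ux.
    by rewrite /f FS // mulmxA.
  rewrite mulmxBr; apply/eqP; rewrite subr_eq0; apply/eqP/matrixP => i k.
  by have /colP/(_ i) := RR (delta_mx k 0); rewrite -!colE !mxE.
exists S; split=> //.
- apply: Zmx_inj => n.
  rewrite (pencil_eq_fiber n AB1 pen1) mulmxA (pencil_eq_fiber n AB pen).
  by apply: FS; apply/hfiber/wfib.
- rewrite -(subrK (alpha *: B1) A1) AB1 -(subrK (alpha *: B) A) AB.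
  rewrite mulmxDr mulmx1 mulmxDl mulVmx // -scalemxAr -scalemxAl; congr (_ + _ *: _).
  by rewrite -mulmxA -SB mulKmx.
- by rewrite -mulmxA -SB mulKmx.
Qed.

End OnOpenSet.
End Representation.

Unset Implicit Arguments.

Theorem theorem6p1 (R : realType) (P Q : {poly CC R}) (N m : nat)
  (hPQ : coprimep P Q) (hdeg : (size Q <= size P)%N)
  (hN : size P = N.+1) (N_gt0 : (0 < N)%N)
  (e : 'I_N -> CC R -> CC R) (he : Lbasis P Q e)
  (alpha : CC R) (halpha : Omega P Q alpha)
  (U : set (CC R)) (hU : open U) (hfiber : rat_fiber P Q alpha `<=` U)
  (X : set (CC R -> 'cV[CC R]_m)) (hX : analytic_space U X)
  (d : nat) (hd : dim_on U X d) :
  [/\ resolvent_invariant P Q alpha X <->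
        exists (M : nat) (G : 'M[CC R]_(N * m, M)) (A B : 'M[CC R]_M),
          \det (A - alpha *: B) != 0 /\ spanned_by_columns P Q e U X G A B,
      resolvent_invariant P Q alpha X ->
        exists (G : 'M[CC R]_(N * m, d)) (A B : 'M[CC R]_d),
          A - alpha *: B = 1%:M /\ spanned_by_columns P Q e U X G A B,
      forall (M : nat) (G : 'M[CC R]_(N * m, M)) (A B : 'M[CC R]_M),
        \det (A - alpha *: B) != 0 -> spanned_by_columns P Q e U X G A B ->
        exists (G' : 'M[CC R]_(N * m, M)) (A' B' : 'M[CC R]_M),
          A' - alpha *: B' = 1%:M /\ spanned_by_columns P Q e U X G' A' B'
    & forall (G G1 : 'M[CC R]_(N * m, d)) (A B A1 B1 : 'M[CC R]_d),
        A - alpha *: B = 1%:M -> spanned_by_columns P Q e U X G A B ->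
        A1 - alpha *: B1 = 1%:M -> spanned_by_columns P Q e U X G1 A1 B1 ->
        exists S : 'M[CC R]_d,
          [/\ S \in unitmx, G1 = G *m S,
              A1 = invmx S *m A *m S & B1 = invmx S *m B *m S]].
Proof.
have [w [winj wfib wsurj]] := fiber_enum hN halpha.
have [F [XF _]] := hd.
have inv2col := invariant_columns hPQ hdeg hN N_gt0 he winj wfib wsurj XF.
split=> //.
- split=> [/inv2col[G [A [B [AB GAB]]]]|[M [G [A [B [dAB GAB]]]]]].
    by exists d, G, A, B; rewrite AB det1 oner_neq0.
  have [G' [A' [B' [AB' GAB']]]] := normalize_columns hdeg N_gt0 he wfib hU hX dAB GAB.
  exact: (columns_invariant hPQ hdeg hN N_gt0 he winj wfib wsurj hU hfiber hX
    AB' GAB').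
- move=> M G A B; exact: (normalize_columns hdeg N_gt0 he wfib hU hX).
- move=> G G1 A B A1 B1.
  exact: (columns_unique hPQ hdeg hN N_gt0 he winj wfib wsurj hU hfiber hX hd).
Qed.
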